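(* Let $d\in\{2,3\}$, let $\lambda,\mu,\rho,\omega>0$ be real constants, and set $k_S=\omega\sqrt{\rho/\mu}$ and $k_P=\omega\sqrt{\rho/(\lambda+2\mu)}$. Let $\mathcal{S}^{d-1}=\{\theta\in\mathbb{R}^d:\|\theta\|=1\}$ be the Euclidean unit sphere and let $F(\theta)=\sum_{i=1}^d\theta_i^4$ for $\theta\in\mathcal{S}^{d-1}$. Consider the two functionals $$J_S(\mu_2)=\max_{\theta\in\mathcal{S}^{d-1}}\left|F(\theta)-\frac{24}{2\mu k_S^2}\,\mu_2\right|\quad(\mu_2\in\mathbb{R}),\qquad J_P(\lambda_2,\mu_2)=\max_{\theta\in\mathcal{S}^{d-1}}\left|F(\theta)-24\,\frac{2\mu_2+\lambda_2}{(4\mu+2\lambda)k_P^2}\right|\quad((\lambda_2,\mu_2)\in\mathbb{R}^2).$$ Then there is a unique pair $(\lambda_2^{\mathrm{asy}},\mu_2^{\mathrm{asy}})\in\mathbb{R}^2$ such that $\mu_2^{\mathrm{asy}}$ minimizes $J_S$ over $\mathbb{R}$ and $(\lambda_2^{\mathrm{asy}},\mu_2^{\mathrm{asy}})$ minimizes $J_P$ over $\mathbb{R}^2$, and it is given by $$\lambda_2^{\mathrm{asy}}=-\frac{\rho\omega^2}{16},\quad \mu_2^{\mathrm{asy}}=\frac{\rho\omega^2}{16}\quad\text{if } d=2,$$ $$\lambda_2^{\mathrm{asy}}=-\frac{\rho\omega^2}{18},\quad \mu_2^{\mathrm{asy}}=\frac{\rho\omega^2}{18}\quad\text{if } d=3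.$$
   Context: Background on where the functionals come from. The isotropic elastic Helmholtz equation $-\mu\Delta u-(\lambda+\mu)\nabla\,\mathrm{div}\,u-\rho\omega^2u=0$ in $\mathbb{R}^d$ has shear (S) and pressure (P) plane waves with wavenumbers $k_S$ and $k_P$. It is discretized by the second-order MAC staggered finite-difference scheme on a uniform mesh of size $h$, with shifted Lamé coefficients $\widehat\lambda=\lambda+h^2\lambda_2$ and $\widehat\mu=\mu+h^2\mu_2$. The discrete wavenumbers of the resulting scheme in direction $\theta\in\mathcal{S}^{d-1}$ expand, as $h\to0$, as $$k_S+h^2\Big(\frac{k_S^3}{24}F(\theta)-\frac{k_S}{2\mu}\mu_2\Big)+\cdots,\qquad k_P+h^2\Big(\frac{k_P^3}{24}F(\theta)-k_P\frac{2\mu_2+\lambda_2}{4\mu+2\lambda}\Big)+\cdots.$$ Minimizing $J_S$ and $J_P$ minimizes the leading-order term of the worst-case (over directions) dispersion error for S- and P-waves respectively. *)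

(* Defs.v *)
From HB Require Import structures.
From mathcomp Require Import all_boot all_order all_algebra.
From mathcomp Require Import all_classical all_reals.
From mathcomp Require Import topology normedtype derive realfun.

Set Implicit Arguments.
Unset Strict Implicit.
Unset Printing Implicit Defensive.

Import Order.TTheory GRing.Theory Num.Theory.
Import numFieldTopology.Exports numFieldNormedType.Exports.

Local Open Scope classical_set_scope.
Local Open Scope ring_scope.

Definition shear_wavenumber (R : realType) (mu rho omega : R) : R :=
  omega * Num.sqrt (rho / mu).

Definition pressure_wavenumber (R : realType) (lambda mu rho omega : R) : R :=
  omega * Num.sqrt (rho / (lambda + 2 * mu)).

(* The library norm on row vectors is the max-norm, hence the explicit
   Euclidean norm. *)
Definition euclidean_norm (R : realType) (d : nat) (theta : 'rV[R]_d) : R :=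
  Num.sqrt (\sum_(i < d) theta ord0 i ^+ 2).

Definition sphere (R : realType) (d : nat) : set 'rV[R]_d :=
  [set theta | euclidean_norm theta = 1].
Arguments sphere : clear implicits.

Definition quartic (R : realType) (d : nat) (theta : 'rV[R]_d) : R :=
  \sum_(i < d) theta ord0 i ^+ 4.

(* The supremum is an attained maximum when 0 < d and g is continuous, see
   sphere_max_attained. *)
Definition sphere_max (R : realType) (d : nat) (g : 'rV[R]_d -> R) : R :=
  sup [set g theta | theta in sphere R d].

Definition J_S (R : realType) (d : nat) (mu k_S : R) (mu2 : R) : R :=
  sphere_max (fun theta : 'rV[R]_d =>
    `|quartic theta - 24 / (2 * mu * k_S ^+ 2) * mu2|).

Definition J_P (R : realType) (d : nat) (lambda mu k_P : R)
    (lambda2 mu2 : R) : R :=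
  sphere_max (fun theta : 'rV[R]_d =>
    `|quartic theta
      - 24 * ((2 * mu2 + lambda2) / ((4 * mu + 2 * lambda) * k_P ^+ 2))|).

Definition minimizes (R : realType) (T : Type) (f : T -> R) (x : T) : Prop :=
  forall y, f x <= f y.

Lemma sphereE (R : realType) (d : nat) (theta : 'rV[R]_d) :
  sphere R d theta <-> \sum_(i < d) theta ord0 i ^+ 2 = 1.
Proof.
rewrite /sphere /euclidean_norm /=; split=> [h|->]; last exact: sqrtr1.
have s0 : 0 <= \sum_(i < d) theta ord0 i ^+ 2.
  by apply: sumr_ge0 => i _; exact: sqr_ge0.
by rewrite -[LHS](sqr_sqrtr s0) h expr1n.
Qed.

Lemma continuous_sum_coordX (R : realType) (d : nat) (k : nat) :
  continuous (fun theta : 'rV[R]_d => \sum_(i < d) theta ord0 i ^+ k).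
Proof.
elim: (index_enum _) => [|i r IH].
  have -> : (fun theta : 'rV[R]_d => \sum_(i <- [::]) theta ord0 i ^+ k) =
      (fun=> 0) by apply/funext => t; rewrite big_nil.
  exact: cst_continuous.
have -> : (fun theta : 'rV[R]_d => \sum_(j <- i :: r) theta ord0 j ^+ k) =
    (fun theta => theta ord0 i ^+ k + \sum_(j <- r) theta ord0 j ^+ k).
  by apply/funext => t; rewrite big_cons.
move=> x; apply: (@cvgD _ _ _ (nbhs x)); last exact: IH.
exact: (continuous_comp (@coord_continuous R 1 d ord0 i x)
  (@exprn_continuous R k (x ord0 i))).
Qed.

Lemma sphere_nonempty (R : realType) (d : nat) : (0 < d)%N -> sphere R d !=set0.
Proof.
move=> d0; pose i0 := Ordinal d0.
exists (delta_mx ord0 i0); apply/sphereE.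
rewrite (bigD1 i0) //= mxE !eqxx expr1n big1 ?addr0 // => i /negbTE ni.
by rewrite mxE eqxx ni expr0n.
Qed.

Lemma sphere_compact (R : realType) (d : nat) : compact (sphere R d).
Proof.
apply: bounded_closed_compact.
  exists 1; split=> // M M1 theta /sphereE h.
  apply: le_trans (ltW M1); rewrite [leLHS]/Num.norm /= mx_normrE.
  apply: bigmax_le => // -[i j] _ /=; rewrite ord1.
  rewrite -(@ler_pXn2r _ 2) ?nnegrE ?normr_ge0 // expr1n real_normK ?num_real//.
  rewrite -h (bigD1 j) //= lerDl; apply: sumr_ge0 => l _; exact: sqr_ge0.
have -> : sphere R d =
    (fun t : 'rV[R]_d => \sum_(i < d) t ord0 i ^+ 2) @^-1` [set 1].
  by apply/seteqP; split=> t /= /sphereE.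
apply: preimage_closed; last exact: closed_eq.
by move=> x _; exact: continuous_sum_coordX.
Qed.

Lemma sphere_max_attained (R : realType) (d : nat) (g : 'rV[R]_d -> R) :
  (0 < d)%N -> continuous g ->
  exists2 theta, sphere R d theta &
    g theta = sphere_max g /\ forall eta, sphere R d eta -> g eta <= g theta.
Proof.
move=> d0 cg.
have [|theta /set_mem St h] :=
    EVT_max_rV (sphere_nonempty R d0) (@sphere_compact R d) (f := g).
  exact: continuous_subspaceT.
have ubg eta : sphere R d eta -> g eta <= g theta by move=> /mem_set /h.
exists theta => //; split=> //; apply/eqP; rewrite eq_le; apply/andP; split.
  apply: ub_le_sup; last by exists theta.
  by exists (g theta) => _ [e Se <-]; exact: ubg.
apply: ge_sup; first by exists (g theta), theta.
by move=> _ [e Se <-]; exact: ubg.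
Qed.

Lemma continuous_dispersion (R : realType) (d : nat) (c : R) :
  continuous (fun theta : 'rV[R]_d => `|quartic theta - c|).
Proof.
move=> x; apply: (@cvg_norm _ _ _ (nbhs x)).
by apply: (@cvgB _ _ _ (nbhs x)); [exact: continuous_sum_coordX|exact: cvg_cst].
Qed.

(* Main.v *)
(* On the sphere F takes its minimum 1/d at the diagonal directions and its
   maximum 1 along the axes, so the maximum of |F - c| is the distance from c to
   the farther endpoint of [1/d, 1], that is (1 - 1/d)/2 + |c - (1 + 1/d)/2|.
   Hence each functional is minimized exactly when its shift c equals the
   midpoint (1 + 1/d)/2. Since mu k_S^2 = (lambda + 2 mu) k_P^2 = rho omega^2,
   this is a triangular linear system in (lambda_2, mu_2). *)
Require Import Defs.
From mathcomp Require Import all_boot all_order all_algebra.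
From mathcomp Require Import all_classical all_reals.
From mathcomp Require Import ring lra.
Import Order.TTheory GRing.Theory Num.Theory.
Local Open Scope ring_scope.

Lemma sphere_axis (R : realType) (d : nat) : (0 < d)%N ->
  exists2 theta : 'rV[R]_d, sphere R d theta & quartic theta = 1.
Proof.
move=> d0; pose i0 := Ordinal d0.
(* The exponent must be positive because [0 ^+ 0 = 1]; it is used with 2 for the norm and 4 for
   [quartic]. *)
have sumX k : (0 < k)%N ->
    \sum_(i < d) (delta_mx ord0 i0 : 'rV[R]_d) ord0 i ^+ k = 1.
  move=> k0; rewrite (bigD1 i0) //= mxE !eqxx expr1n big1 ?addr0 //.
  by move=> i /negbTE ni; rewrite mxE eqxx ni expr0n; case: k k0.
exists (delta_mx ord0 i0); last exact: sumX.
by apply/sphereE; exact: sumX.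
Qed.

Lemma sphere_diagonal (R : realType) (d : nat) : (0 < d)%N ->
  exists2 theta : 'rV[R]_d, sphere R d theta & quartic theta = d%:R^-1.
Proof.
move=> d0; have dN0 : d%:R != 0 :> R by rewrite pnatr_eq0 -lt0n.
pose s : R := Num.sqrt d%:R^-1.
have s2 : s ^+ 2 = d%:R^-1 by rewrite sqr_sqrtr // invr_ge0 ler0n.
exists (const_mx s).
  apply/sphereE; under eq_bigr do rewrite mxE s2.
  by rewrite sumr_const card_ord -[LHS]mulr_natl divff.
rewrite /quartic; under eq_bigr do rewrite mxE (exprM _ 2 2) s2.
by rewrite sumr_const card_ord -[LHS]mulr_natl expr2 mulrA divff ?mul1r.
Qed.

(** Each squared coordinate is at most 1, so fourth powers are bounded termwise by squares, which
    sum to 1. *)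
Lemma quartic_le1 (R : realType) (d : nat) (theta : 'rV[R]_d) :
  sphere R d theta -> quartic theta <= 1.
Proof.
move=> /sphereE h; rewrite /quartic -[leRHS]h; apply: ler_sum => i _.
have ti1 : theta ord0 i ^+ 2 <= 1.
  by rewrite -h (bigD1 i) //= lerDl; apply: sumr_ge0 => j _; exact: sqr_ge0.
by rewrite (exprM _ 2 2) expr2 ler_piMl ?sqr_ge0.
Qed.

(** On the sphere the squared deviations of the [theta_i ^+ 2] from their mean [1/d] add up to
    [quartic theta - 1/d]. *)
Lemma quartic_ge_inv (R : realType) (d : nat) (theta : 'rV[R]_d) :
  (0 < d)%N -> sphere R d theta -> d%:R^-1 <= quartic theta.
Proof.
move=> d0 /sphereE h; have dN0 : d%:R != 0 :> R by rewrite pnatr_eq0 -lt0n.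
have : 0 <= \sum_(i < d) (theta ord0 i ^+ 2 - d%:R^-1) ^+ 2.
  by apply: sumr_ge0 => i _; exact: sqr_ge0.
have -> : \sum_(i < d) (theta ord0 i ^+ 2 - d%:R^-1) ^+ 2 =
    \sum_(i < d) (theta ord0 i ^+ 4 - (2 / d%:R) * theta ord0 i ^+ 2
                  + d%:R^-1 ^+ 2).
  by apply: eq_bigr => i _; field.
rewrite big_split sumrB -mulr_sumr h sumr_const card_ord /= -/(quartic theta).
rewrite -(mulr_natl (d%:R^-1 ^+ 2)) expr2 mulrA divff //; lra.
Qed.

Lemma sphere_max_dispersion (R : realType) (d : nat) (c : R) : (0 < d)%N ->
  sphere_max (fun theta : 'rV[R]_d => `|quartic theta - c|) =
  (1 - d%:R^-1) / 2 + `|c - (1 + d%:R^-1) / 2|.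
Proof.
move=> d0.
have [theta St [<- maxt]] := sphere_max_attained d0 (@continuous_dispersion R d c).
have [a Sa Fa] := sphere_axis R d d0; have [b Sb Fb] := sphere_diagonal R d d0.
have := maxt a Sa; have := maxt b Sb; rewrite Fa Fb.
have := quartic_le1 _ _ _ St; have := quartic_ge_inv _ _ _ d0 St.
move: (quartic theta) (d%:R^-1) => F m mF F1 hm h1.
(* The upper bound needs only [m <= F <= 1] at the maximizer; the lower bound compares it with the
   diagonal ([hm]) and the axis ([h1]). *)
apply/eqP; rewrite eq_le; apply/andP; split.
  rewrite ler_norml; have := ler_norm (c - (1 + m) / 2).
  have := ler_norm (- (c - (1 + m) / 2)); rewrite normrN.
  by move=> ? ?; apply/andP; split; lra.
have := ler_norm (1 - c); have := ler_norm (- (m - c)); rewrite normrN.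
by case: (ger0P (c - (1 + m) / 2)) => ? ? ?; lra.
Qed.

(** Reaching the midpoint makes the absolute value vanish, so a minimizer must do so too. The type
    [T] is [R] for [J_S] and [R * R] for [J_P]. *)
Lemma minimizes_sphere_max_dispersion (R : realType) (d : nat) (T : Type)
    (c : T -> R) (x : T) : (0 < d)%N ->
    (exists y, c y = (1 + d%:R^-1) / 2) ->
  minimizes (fun t =>
    sphere_max (fun theta : 'rV[R]_d => `|quartic theta - c t|)) x <->
  c x = (1 + d%:R^-1) / 2.
Proof.
move=> d0 [y cy]; split=> [/(_ y)|cx z]; rewrite !sphere_max_dispersion //.
  by rewrite cy subrr normr0 lerD2l normr_le0 subr_eq0 => /eqP.
by rewrite cx subrr normr0 lerD2l normr_ge0.
Qed.

(** Turns both shifts into multiples of [12 / (rho * omega ^+ 2)]; P-waves are covered by taking the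
    modulus [lambda + 2 * mu]. *)
Lemma shear_wavenumber_sqr (R : realType) (mu rho omega : R) :
  0 < mu -> 0 < rho -> mu * shear_wavenumber mu rho omega ^+ 2 = rho * omega ^+ 2.
Proof.
move=> mu0 rho0; rewrite /shear_wavenumber exprMn sqr_sqrtr ?divr_ge0 ?ltW //.
by field; rewrite gt_eqF.
Qed.

Lemma pressure_wavenumberE (R : realType) (lambda mu rho omega : R) :
  pressure_wavenumber lambda mu rho omega
  = shear_wavenumber (lambda + 2 * mu) rho omega.
Proof. by []. Qed.

Theorem theorem4p2 (R : realType) (d : nat) (hd : d = 2%N \/ d = 3%N)
    (lambda mu rho omega : R)
    (hlambda : 0 < lambda) (hmu : 0 < mu) (hrho : 0 < rho)
    (homega : 0 < omega) :
  let k_S := shear_wavenumber mu rho omega in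
  let k_P := pressure_wavenumber lambda mu rho omega in
  exists p : R * R,
    unique (fun q : R * R =>
      minimizes (J_S d mu k_S) q.2 /\
      minimizes (fun r : R * R => J_P d lambda mu k_P r.1 r.2) q) p /\
    (d = 2%N -> p = (- (rho * omega ^+ 2 / 16), rho * omega ^+ 2 / 16)) /\
    (d = 3%N -> p = (- (rho * omega ^+ 2 / 18), rho * omega ^+ 2 / 18)).
Proof.
move=> k_S k_P.
have d0 : (0 < d)%N by case: hd => ->.
set K := rho * omega ^+ 2.
have K0 : K != 0 by rewrite gt_eqF // mulr_gt0 ?exprn_gt0.
set m : R := (1 + d%:R^-1) / 2.
have eS (x : R) : (24 / (2 * mu * k_S ^+ 2) * x = m) <-> (x = K * m / 12).
  have -> : 2 * mu * k_S ^+ 2 = 2 * K by rewrite -mulrA shear_wavenumber_sqr.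
  by split=> [<-|->]; field.
have eP (r : R * R) :
    (24 * ((2 * r.2 + r.1) / ((4 * mu + 2 * lambda) * k_P ^+ 2)) = m) <->
    (2 * r.2 + r.1 = K * m / 12).
  have -> : (4 * mu + 2 * lambda) * k_P ^+ 2 = 2 * K.
    have L0 : 0 < lambda + 2 * mu by rewrite addr_gt0 ?mulr_gt0.
    rewrite /K -(shear_wavenumber_sqr _ _ _ omega L0 hrho) /k_P.
    by rewrite pressure_wavenumberE; ring.
  by split=> [<-|->]; field.
have minS x : minimizes (J_S d mu k_S) x <-> x = K * m / 12.
  rewrite -eS; apply: minimizes_sphere_max_dispersion => //.
  by exists (K * m / 12); apply/eS.
have minP q : minimizes (fun r : R * R => J_P d lambda mu k_P r.1 r.2) q <->
    2 * q.2 + q.1 = K * m / 12.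
  rewrite -eP.
  apply: (@minimizes_sphere_max_dispersion R d _ (fun r : R * R => _)) => //.
  (* The minimizers of [J_P] form a whole line; its point with zero second entry is a convenient
     witness. *)
  by exists (K * m / 12, 0); apply/eP; rewrite /= mulr0 add0r.
(* Subtracting the two conditions forces [lambda2 = - mu2]. Here [m] is 3/4 for [d = 2] and 2/3 for
   [d = 3], whence [K / 16] and [K / 18]. *)
exists (- (K * m / 12), K * m / 12); split; last first.
  by split=> d_eq; rewrite /m d_eq; congr (_, _); field.
split=> [|[l x] [/= /minS -> /minP /= e]].
  by split; [apply/minS | apply/minP => /=; ring].
by congr (_, _); lra.
Qed.
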